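(* Let $G$ be a finite connected simple graph with $n$ vertices labelled $1,\dots,n$, and let $\kappa(G)$ be its number of spanning trees. The number of chip configurations debt-reachable from $(c,0,0,\dots,0)$ on $G$, as a function of the nonnegative integer $c$, is a quasipolynomial in $c$ of degree $n-1$ whose period divides $\kappa(G)$.
   Context: A chip configuration on $G$ is an $n$-tuple of nonnegative integers $(c_1,\dots,c_n)$, with $c_i$ the number of chips on vertex $i$. A (general) chip-firing move at vertex $i$, of degree $d_i$, subtracts $d_i$ chips from vertex $i$ and adds one chip to each vertex adjacent to $i$; no condition is imposed on the current number of chips on $i$, so intermediate tuples may have negative entries. A chip configuration $C'$ is debt-reachable from a chip configuration $C$ if some finite (possibly empty) sequence of general chip-firing moves transforms $C$ into $C'$; both $C$ and $C'$ must have nonnegative entries. A quasipolynomial is a function $q:\mathbb{Z}\to\mathbb{Z}$ of the form $q(k)=a_d(k)k^d+a_{d-1}(k)k^{d-1}+\dots+a_0(k)$, where the $a_i$ are periodic functions of $k$ with integer period; its degree is $d$ if $a_d$ is not identically zero, and its period is the least common multiple of the periods of the $a_i$. Saying that a count depending on $c\ge 0$ is a quasipolynomial in $c$ means it agrees with such a $q$ at all integers $c\ge 0$. *)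

(* Defs.v *)
From mathcomp Require Import all_boot all_order all_algebra.
From mathcomp Require Import finmap boolp classical_sets functions cardinality.

Set Implicit Arguments.
Unset Strict Implicit.
Unset Printing Implicit Defensive.

Import GRing.Theory.
Local Open Scope ring_scope.

(* A finite simple graph on V is a symmetric irreflexive e : rel V. *)

Definition connected_graph (V : finType) (e : rel V) : bool :=
  [forall x, forall y, connect e x y].

(* A cycle of a simple graph has at least three vertices; one without repeated
   vertices has at most #|V|, so quantifying over bounded tuples loses nothing
   (see acyclic_graphP). *)
Definition acyclic_graph (V : finType) (e : rel V) : bool :=
  [forall k : 'I_#|V|.+1, forall p : k.-tuple V,
    (2 < k)%N ==> ~~ (cycle e p && uniq p)].

Lemma acyclic_graphP (V : finType) (e : rel V) :
  reflect (forall p : seq V, (2 < size p)%N -> cycle e p -> ~~ uniq p)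
          (acyclic_graph e).
Proof.
apply: (iffP forallP) => [acy p p2 cp | acy k].
  apply/negP => up.
  have lp : (size p < #|V|.+1)%N by rewrite ltnS -(card_uniqP up) max_card.
  have /forallP/(_ (in_tuple p)) := acy (Ordinal lp).
  by rewrite /= p2 cp up.
apply/forallP => p; apply/implyP => k2; apply/negP => /andP[cp].
by apply/negP; apply: acy => //; rewrite size_tuple.
Qed.

Definition edges (V : finType) (e : rel V) : {set {set V}} :=
  [set A : {set V} | [exists x, exists y, e x y && (A == [set x; y]%SET)]]%SET.

Definition edge_rel (V : finType) (F : {set {set V}}) : rel V :=
  [rel x y | (x != y) && ([set x; y]%SET \in F)].

Definition spanning_tree (V : finType) (e : rel V) (F : {set {set V}}) : bool :=
  [&& F \subset edges e, connected_graph (edge_rel F)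
    & acyclic_graph (edge_rel F)].

Definition num_spanning_trees (V : finType) (e : rel V) : nat :=
  #|[set F : {set {set V}} | spanning_tree e F]%SET|.

Definition degree (V : finType) (e : rel V) (i : V) : nat :=
  #|[set j | e i j]%SET|.

Definition configuration (V : finType) := {ffun V -> nat}.

Definition fire (V : finType) (e : rel V) (C : {ffun V -> int}) (i : V) :
    {ffun V -> int} :=
  [ffun j => C j - (if j == i then (degree e i)%:Z else 0)
                 + (if e i j then 1 else 0)].

Definition to_int (V : finType) (C : configuration V) : {ffun V -> int} :=
  [ffun j => (C j)%:Z].

Definition debt_reachable (V : finType) (e : rel V) (C C' : configuration V) :
    Prop :=
  exists s : seq V, foldl (fire e) (to_int C) s = to_int C'.

Definition all_chips_at (V : finType) (v : V) (c : nat) : configuration V :=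
  [ffun j => if j == v then c else 0%N].

Definition reachable_set (V : finType) (e : rel V) (C : configuration V) :
    set (configuration V) :=
  [set C' | debt_reachable e C C']%classic.

Definition has_period (T : Type) (a : int -> T) (p : nat) : Prop :=
  (0 < p)%N /\ forall k : int, a (k + p%:Z) = a k.

Definition is_period (T : Type) (a : int -> T) (p : nat) : Prop :=
  has_period a p /\ forall p' : nat, has_period a p' -> (p <= p')%N.

(* Each a i takes values in rat: the coefficients of an integer-valued
   quasipolynomial are rational, but not integral in general. *)
Definition is_quasipolynomial (q : int -> int) (d p : nat) : Prop :=
  exists (a : 'I_d.+1 -> int -> rat) (per : 'I_d.+1 -> nat),
    [/\ forall i, is_period (a i) (per i),
        exists k : int, a ord_max k <> 0,
        p = (\big[lcmn/1%N]_(i < d.+1) per i)%N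
      & forall k : int, (q k)%:~R = \sum_(i < d.+1) a i k * k%:~R ^+ i].

(* Main.v *)
Require Import Defs.
From mathcomp Require Import all_boot all_order all_algebra.
From mathcomp Require Import finmap boolp classical_sets functions cardinality.
From mathcomp Require Import zify ring.

(** Write [k] for the number of spanning trees and [m] for the number of
    vertices other than the base vertex [ord0].  Firing moves add or subtract
    columns of the Laplacian and the columns sum to zero, so a configuration is
    debt-reachable from another exactly when their difference lies in the image
    of the Laplacian over the integers ([debt_reachableP]); such differences are
    called [principal] below.

    Two ingredients give the theorem.

    The first is that [k * (e_i - e_j)] is principal for all vertices [i] and
    [j] ([principal_num_spanning_trees]).  An explicit potential is available:
    let [x v] count the two-component spanning forests rooted at [i] and [j] in
    which [v] lies in the tree of [i].  Forests are encoded as parent maps, the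
    roots being the fixed points.  At a vertex [v] that is not a root, the pairs
    (forest, neighbour [u] of [v]) carry an involution which replaces the parent
    of [v] by [u] and [u] by the old parent, as long as this creates no cycle;
    it exchanges the statements [v is below i] and [u is below i], and this says
    that [x] is harmonic at [v].  At [i] the net flow counts the ways to attach
    [i] to a neighbour in the tree of [j], that is the spanning trees rooted at
    [j] ([potential_source]).  Rooted parent maps and spanning trees correspond
    one to one ([num_rooted_treesE]), so this flow is [k].

    The second is lattice point counting.  A configuration reachable from
    [(c, 0, ..., 0)] has [c] chips, so it is determined by its restriction [y] to
    the [m] vertices other than [ord0], subject to [sum y <= c] and to a condition
    on [y] that by the first ingredient depends only on [y] modulo [k].  Dividing
    the entries by [k], the vectors with a given residue vector [r] are counted by
    the binomial coefficient ['C(floor((c - |r|) / k) + m, m)].  As a function of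
    [c] this is a polynomial of degree [m] with leading coefficient
    [1 / (m! k^m)] on each class modulo [k].  Summing over the admissible [r],
    among which is [r = 0], gives a quasipolynomial whose degree is exactly [m]
    and whose coefficients have periods dividing [k]. *)

Set Implicit Arguments.
Unset Strict Implicit.
Unset Printing Implicit Defensive.

Import Order.TTheory GRing.Theory Num.Theory.
Local Open Scope ring_scope.

(** * Spanning forests as parent maps *)

Section ParentMaps.

Variables (V : finType).
Implicit Types (e : rel V) (f : {ffun V -> V}) (i j r u v w : V).

Definition redirect f v u : {ffun V -> V} := [ffun w => if w == v then u else f w].

(** A spanning forest whose trees are rooted at the points of [S], given by the
    map sending each vertex to its parent; the roots are their own parents. *)
Definition rooted_forest e (S : {set V}) f : bool :=
  [forall v, if v \in S then f v == v else e v (f v)] &&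
  [forall v, [exists r in S, fconnect f v r]].

Lemma rooted_forestP e (S : {set V}) f :
  reflect [/\ forall v, v \in S -> f v = v,
              forall v, v \notin S -> e v (f v)
            & forall v, exists2 r, r \in S & fconnect f v r]
          (rooted_forest e S f).
Proof.
apply: (iffP andP) => [[/forallP h1 /forallP h2] | [h1 h2 h3]]; split.
- by move=> v vS; have := h1 v; rewrite vS => /eqP.
- by move=> v vS; have := h1 v; rewrite (negbTE vS).
- by move=> v; have /existsP[r /andP[]] := h2 v; exists r.
- by apply/forallP => v; case: ifP => [/h1 ->//|/negbT /h2].
- by apply/forallP => v; have [r rS vr] := h3 v; apply/existsP; exists r; rewrite rS.
Qed.

Lemma redirect_same f v u : redirect f v u v = u.
Proof. by rewrite ffunE eqxx. Qed.

Lemma redirect_diff f v u w : w != v -> redirect f v u w = f w.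
Proof. by rewrite ffunE => /negbTE ->. Qed.

Lemma redirect_id f v : redirect f v (f v) = f.
Proof. by apply/ffunP => w; rewrite !ffunE; case: eqP => [->|]. Qed.

Lemma redirect_redirect f v u u' : redirect (redirect f v u) v u' = redirect f v u'.
Proof. by apply/ffunP => w; rewrite !ffunE; case: eqP. Qed.

Lemma fconnect_step f v u : fconnect f (f v) u -> fconnect f v u.
Proof. by apply: connect_trans; exact: fconnect1. Qed.

Lemma fconnect_iterP f v u :
  reflect (exists k, iter k f v = u) (fconnect f v u).
Proof.
apply: (iffP idP) => [/iter_findex <-|[k <-]]; last exact: fconnect_iter.
by exists (findex f v u).
Qed.

Lemma fconnect_fix f r v : f r = r -> fconnect f r v -> v = r.
Proof.
by move=> fr /fconnect_iterP[k <-]; elim: k => //= k ->.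
Qed.

Lemma fconnect_fix_uniq f r s v :
  f r = r -> f s = s -> fconnect f v r -> fconnect f v s -> r = s.
Proof.
move=> fr fs /fconnect_iterP[k]; elim: k v => [|k IH] v.
  by move=> /= -> /(fconnect_fix fr).
rewrite iterSr => /IH {}IH; rewrite fconnect_eqVf => /orP[/eqP vs|/IH//].
by apply: IH; rewrite vs fs connect0.
Qed.

(** A vertex on a cycle never leaves that cycle, and so reaches a fixed point
    only if it is that fixed point. *)
Lemma fconnect_acyclic f r v :
  f r = r -> fconnect f v r -> v != r -> ~~ fconnect f (f v) v.
Proof.
move=> fr /fconnect_iterP[k]; elim: k v => [|k IH] v.
  by move=> /= ->; rewrite eqxx.
rewrite iterSr => fvr v_r; apply/negP => fvv.
have fv_r : f v != r.
  by apply: contraNneq v_r => fv; move: fvv; rewrite fv => /(fconnect_fix fr) ->.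
have /negP := IH _ fvr fv_r; apply.
move: fvv; rewrite {1}fconnect_eqVf => /orP[/eqP fv|ffv]; first by rewrite !fv connect0.
exact: connect_trans ffv (fconnect1 _ _).
Qed.

Lemma redirect_iter f v u w k :
  ~~ fconnect f w v -> iter k (redirect f v u) w = iter k f w.
Proof.
move=> wv; elim: k => //= k ->; apply: redirect_diff.
by apply: contraNneq wv => <-; apply: fconnect_iter.
Qed.

Lemma redirect_fconnect_avoid f v u w r :
  ~~ fconnect f w v -> fconnect (redirect f v u) w r = fconnect f w r.
Proof.
move=> wv; apply/idP/idP => /fconnect_iterP[k <-].
  by rewrite redirect_iter // fconnect_iter.
by rewrite -(redirect_iter u k wv) fconnect_iter.
Qed.

(** The part of an orbit before its first visit to [v] survives the
    redirection. *)
Lemma redirect_fconnect_self f v u w :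
  fconnect f w v -> fconnect (redirect f v u) w v.
Proof.
move=> /fconnect_iterP[k]; elim: k w => [w /= ->|k IH w]; first exact: connect0.
rewrite iterSr => /IH fwv; have [->|w_v] := eqVneq w v; first exact: connect0.
by apply: fconnect_step; rewrite redirect_diff.
Qed.

Lemma rooted_forest_acyclic e (S : {set V}) f v :
  rooted_forest e S f -> v \notin S -> ~~ fconnect f (f v) v.
Proof.
case/rooted_forestP => fS _ reach vS; have [r rS vr] := reach v.
by apply: (fconnect_acyclic (fS r rS) vr); apply: contraNneq vS => ->.
Qed.

(** The orbit of [u] avoids [v], so it still ends at a root, and the whole subtree
    of [v] now follows it. *)
Lemma redirect_rooted_forest e (S : {set V}) f v u :
  rooted_forest e S f -> e v u -> ~~ fconnect f u v -> v \notin S ->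
  rooted_forest e S (redirect f v u).
Proof.
move=> /rooted_forestP[fS fe reach] evu uv vS.
have reach_u : exists2 r, r \in S & fconnect (redirect f v u) v r.
  have [r rS ur] := reach u; exists r => //.
  by apply: fconnect_step; rewrite redirect_same redirect_fconnect_avoid.
apply/rooted_forestP; split=> w.
- by move=> wS; rewrite redirect_diff ?fS //; apply: contraTneq wS => ->.
- by move=> wS; rewrite ffunE; case: eqP => [->|_] //; exact: fe.
- have [wv|wv] := boolP (fconnect f w v); last first.
    by have [r rS wr] := reach w; exists r; rewrite ?redirect_fconnect_avoid.
  have [r rS vr] := reach_u; exists r => //.
  exact: connect_trans (redirect_fconnect_self _ wv) vr.
Qed.

(** Forests with the extra root [i], together with an edge from [i] to another
    tree, correspond to forests without it: [cut_rooted_forest] turns the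
    non-root [i] into a root, [join_rooted_forest] attaches it again. *)
Lemma cut_rooted_forest e (S : {set V}) f i :
  rooted_forest e S f -> i \notin S ->
  rooted_forest e (i |: S) (redirect f i i).
Proof.
move=> /rooted_forestP[fS fe reach] iS.
apply/rooted_forestP; split=> w.
- rewrite in_setU1 => /orP[/eqP->|wS]; first exact: redirect_same.
  by rewrite redirect_diff ?fS //; apply: contraTneq wS => ->.
- by rewrite in_setU1 negb_or => /andP[wi /fe]; rewrite redirect_diff.
- have [wi|wi] := boolP (fconnect f w i).
    by exists i; [exact: setU11 | exact: redirect_fconnect_self].
  have [r rS wr] := reach w; exists r; last by rewrite redirect_fconnect_avoid.
  exact: setU1r.
Qed.

Lemma join_rooted_forest e (S : {set V}) f i u :
  rooted_forest e (i |: S) f -> i \notin S -> e i u -> ~~ fconnect f u i ->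
  rooted_forest e S (redirect f i u).
Proof.
move=> /rooted_forestP[fS fe reach] iS eiu ui.
have avoid w : ~~ fconnect f w i ->
    exists2 r, r \in S & fconnect (redirect f i u) w r.
  move=> wi; have [r] := reach w; rewrite in_setU1 => /orP[/eqP->|].
    by rewrite (negbTE wi).
  by exists r; rewrite ?redirect_fconnect_avoid.
apply/rooted_forestP; split=> w.
- by move=> wS; rewrite redirect_diff ?fS ?setU1r //; apply: contraTneq wS => ->.
- move=> wS; rewrite ffunE; have [->//|wi] := eqVneq w i.
  by apply: fe; rewrite in_setU1 negb_or wi.
- have [wi|] := boolP (fconnect f w i); last exact: avoid.
  have [r rS ur] := avoid u ui; exists r => //.
  apply: connect_trans (redirect_fconnect_self _ wi) _.
  by apply: fconnect_step; rewrite redirect_same.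
Qed.

End ParentMaps.

(** * A potential counting two-rooted forests *)

Section Potential.

Variables (V : finType) (e : rel V) (i j : V).

Definition num_rooted_trees : nat := #|[set f | rooted_forest e [set j] f]%SET|.

Let forest2 := rooted_forest e [set i; j]%SET.

Definition potential v : nat :=
  #|[set f | rooted_forest e [set i; j]%SET f && fconnect f v i]%SET|.

(** The exchange of the parent of [v] with a neighbour of [v].  It is the
    identity when the neighbour is below [v], where redirecting would close a
    cycle; the neighbour and [v] are then in the same tree. *)
Definition swap_edge v (p : V * {ffun V -> V}) : V * {ffun V -> V} :=
  if [&& e v p.1, forest2 p.2 & ~~ fconnect p.2 p.1 v]
  then (p.2 v, redirect p.2 v p.1) else p.

(** The old parent of [v] is again a neighbour outside the subtree of [v], so a
    second exchange undoes the first. *)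
Lemma swap_edge_domain v (p : V * {ffun V -> V}) : v \notin [set i; j]%SET ->
  [&& e v p.1, forest2 p.2 & ~~ fconnect p.2 p.1 v] ->
  [&& e v (p.2 v), forest2 (redirect p.2 v p.1)
    & ~~ fconnect (redirect p.2 v p.1) (p.2 v) v].
Proof.
move=> vS /and3P[ep pF pv].
have fvv := rooted_forest_acyclic pF vS.
rewrite /forest2 redirect_rooted_forest //= redirect_fconnect_avoid // fvv andbT.
by have /rooted_forestP[_ ->] := pF.
Qed.

Lemma swap_edgeK v : v \notin [set i; j]%SET -> involutive (swap_edge v).
Proof.
move=> vS p; rewrite {2}/swap_edge; case: ifP => pP; last by rewrite /swap_edge pP.
rewrite /swap_edge swap_edge_domain //= redirect_redirect redirect_same redirect_id.
by case: (p).
Qed.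

Lemma potentialE v :
  potential v = (\sum_(f | forest2 f) fconnect f v i)%N.
Proof.
rewrite /potential cardsE -sum1_card big_mkcond [RHS]big_mkcond /=.
by apply: eq_bigr => f _; rewrite unfold_in /= /forest2; case: rooted_forest; case: (fconnect f v i).
Qed.

(** Both sides count pairs of a neighbour [u] and a forest, those with [v] in the
    tree of [i] and those with [u] in the tree of [i]; the exchange turns one
    count into the other. *)
Lemma potential_harmonic v : v != i -> v != j ->
  (\sum_(u | e v u) potential v = \sum_(u | e v u) potential u)%N.
Proof.
move=> vi vj; have vS : v \notin [set i; j]%SET by rewrite !inE negb_or vi.
under eq_bigr do rewrite potentialE.
under [RHS]eq_bigr do rewrite potentialE.
rewrite !pair_big_dep /= (reindex_inj (inv_inj (swap_edgeK vS))) /=.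
apply: eq_big => [p|p].
  rewrite /swap_edge; case: ifP => // pP.
  by have /and3P[/= -> -> _] := swap_edge_domain vS pP; have /and3P[-> -> _] := pP.
rewrite {1 2}/swap_edge; case: ifP => pP.
  have /and3P[ep pF pv] := pP; rewrite /swap_edge pP /= => _.
  rewrite fconnect_eqVf (negbTE vi) redirect_same /=.
  by rewrite redirect_fconnect_avoid.
(* The exchange fixes [p]: the neighbour reaches [v], hence the same root. *)
move=> /andP[ep pF]; rewrite /swap_edge pP.
have pv : fconnect p.2 p.1 v by move: pP; rewrite ep pF /= => /negbFE.
have /rooted_forestP[fS _ reach] := pF.
congr nat_of_bool; apply/idP/idP => [|pi]; first exact: connect_trans.
have [r rS vr] := reach v.
suff -> : i = r by [].
by apply: (@fconnect_fix_uniq _ p.2 _ _ p.1); rewrite ?fS ?set21 //; apply: connect_trans vr.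
Qed.

(** Since [i] is always in its own tree, the difference of the two sums counts the
    neighbours of [i] that are in the tree of [j], over all forests; attaching
    [i] to such a neighbour yields each tree rooted at [j] exactly once. *)
Lemma potential_source : irreflexive e -> i != j ->
  (\sum_(u | e i u) potential i = \sum_(u | e i u) potential u + num_rooted_trees)%N.
Proof.
move=> e_irr ij; have iS : i \notin [set j]%SET by rewrite inE.
under eq_bigr do rewrite potentialE.
under [X in _ = (X + _)%N]eq_bigr do rewrite potentialE.
rewrite !pair_big_dep /=.
have -> : num_rooted_trees =
    (\sum_(p : V * {ffun V -> V} | e i p.1 && forest2 p.2) ~~ fconnect p.2 p.1 i)%N.
  rewrite -big_mkcondr /= sum1_card.
  pose cut (f : {ffun V -> V}) := (f i, redirect f i i).
  rewrite /num_rooted_trees -(card_in_imset (f := cut)) => [|f g _ _ []]; last first.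
    move=> fi /(congr1 (fun h => redirect h i (f i))).
    by rewrite fi !redirect_redirect -{1}fi !redirect_id.
  apply: eq_card => -[u f]; rewrite !unfold_in /=; apply/imsetP/idP.
    case=> g; rewrite inE => gF [-> ->].
    rewrite /forest2 cut_rooted_forest // redirect_fconnect_avoid ?(rooted_forest_acyclic gF) //.
    by have /rooted_forestP[_ -> //] := gF.
  case/andP=> /andP[eu fF] ui; exists (redirect f i u).
    by rewrite inE join_rooted_forest.
  have /rooted_forestP[fi _ _] := fF.
  by rewrite /cut redirect_same redirect_redirect -{2}(fi i) ?set21 // redirect_id.
rewrite -big_split /=; apply: eq_bigr => p _; rewrite connect0.
by case: (fconnect p.2 p.1 i).
Qed.

End Potential.

(** * Rooted trees and spanning trees *)

Section SpanningTrees.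

Variables (V : finType) (j : V).
Implicit Types (e r : rel V) (f : {ffun V -> V}) (v w : V).

Definition parent_edges f : {set {set V}} := [set [set v; f v] | v in ~: [set j]]%SET.

Lemma edge_rel_sym (F : {set {set V}}) : symmetric (edge_rel F).
Proof. by move=> v w; rewrite /edge_rel /= eq_sym finset.setUC. Qed.

Lemma parent_edgesP f v w :
  reflect ((v != j /\ w = f v) \/ (w != j /\ v = f w))
          ([set v; w]%SET \in parent_edges f).
Proof.
apply: (iffP imsetP) => [[x xj vw]|[[vj ->]|[wj ->]]].
- move: xj; rewrite !inE => xj.
  have: x \in [set v; w]%SET by rewrite vw set21.
  have: f x \in [set v; w]%SET by rewrite vw set22.
  have: v \in [set x; f x]%SET by rewrite -vw set21.
  have: w \in [set x; f x]%SET by rewrite -vw set22.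
  rewrite !inE => /orP[/eqP->|/eqP->] /orP[/eqP->|/eqP->]; [| by right | by left |].
  + by rewrite orbb => /eqP fx _; left; rewrite fx.
  + by rewrite orbb => _ /orP[]/eqP fx; left; rewrite -fx.
- by exists v => //; rewrite !inE.
- by exists w; rewrite ?inE // finset.setUC.
Qed.

Lemma rooted_tree_edge e f v : irreflexive e -> rooted_forest e [set j]%SET f ->
  v != j -> edge_rel (parent_edges f) v (f v).
Proof.
move=> e_irr /rooted_forestP[_ fe _] vj; apply/andP; split; last first.
  by apply/parent_edgesP; left.
by apply: contraTneq (fe v _) => [<-|]; rewrite ?e_irr // inE.
Qed.

Lemma rooted_treeP e f : rooted_forest e [set j]%SET f ->
  [/\ f j = j, forall v, v != j -> e v (f v) & forall v, fconnect f v j].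
Proof.
case/rooted_forestP => fj fe reach; split.
- by rewrite fj ?inE.
- by move=> v vj; rewrite fe ?inE.
- by move=> v; have [r] := reach v; rewrite inE => /eqP ->.
Qed.

Lemma rooted_tree_connected e f : irreflexive e -> rooted_forest e [set j]%SET f ->
  connected_graph (edge_rel (parent_edges f)).
Proof.
move=> e_irr fT; have [fj fe reach] := rooted_treeP fT.
have to_j v : connect (edge_rel (parent_edges f)) v j.
  have /fconnect_iterP[k] := reach v; elim: k v => [v /= ->|k IH v]; first exact: connect0.
  rewrite iterSr => /IH; apply: connect_trans.
  have [->|vj] := eqVneq v j; first by rewrite fj connect0.
  by apply: connect1; apply: rooted_tree_edge fT vj.
apply/forallP => v; apply/forallP => w; apply: connect_trans (to_j v) _.
by rewrite (sym_connect_sym (edge_rel_sym _)).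
Qed.

(** A deepest vertex of a cycle has no child on it, so both its neighbours on
    the cycle are its parent, hence equal, and the cycle has only two vertices. *)
Lemma rooted_tree_acyclic e f : rooted_forest e [set j]%SET f ->
  acyclic_graph (edge_rel (parent_edges f)).
Proof.
move=> fT; have [fj fe reach] := rooted_treeP fT.
pose depth v := findex f v j.
have depthS v : v != j -> depth v = (depth (f v)).+1.
  by rewrite eq_sym => vj; apply: fconnect_findex vj; exact: reach.
apply/acyclic_graphP => p p2 pc; apply/negP => pu.
have x0 : {x | x \in p} by case: (p) p2 => // x s _; exists x; exact: mem_head.
case: x0 => x0 x0p.
have [v vp vmax] := @arg_maxnP _ x0 (fun x => x \in p) depth x0p.
have up w : w \in p -> edge_rel (parent_edges f) v w -> w = f v.
  move=> wp /andP[_ /parent_edgesP[[]//|[wj vw]]].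
  by have := vmax w wp; rewrite (depthS w) // -vw /= ltnn.
(* Rotate the cycle to [v, a, ..., b], so that [a] and [b] are adjacent to [v]. *)
have [k s ps] := rot_to vp.
move: pc pu p2 up; rewrite -(rot_cycle k) -(rot_uniq k) -(size_rot k) ps.
have mem_s w : (w \in p) = (w \in v :: s) by rewrite -ps mem_rot.
case: s ps mem_s => [|a s] ps mem_s //; case/lastP: s ps mem_s => [|s b] ps mem_s //.
rewrite /= rcons_path last_rcons => /andP[va /andP[_ bv]] /and3P[_ ab _] _ up.
have av : a = f v by apply: up => //; rewrite mem_s !inE eqxx orbT.
have bv' : b = f v.
  by apply: up; rewrite ?mem_s ?inE ?mem_rcons ?inE ?eqxx ?orbT // edge_rel_sym.
by move: ab; rewrite av bv' mem_rcons mem_head.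
Qed.

Lemma rooted_tree_spanning e f : irreflexive e -> rooted_forest e [set j]%SET f ->
  spanning_tree e (parent_edges f).
Proof.
move=> e_irr fT; apply/and3P; split; last exact: rooted_tree_acyclic fT.
  apply/fintype.subsetP => A /imsetP[v]; rewrite !inE => vj ->.
  have [_ fe _] := rooted_treeP fT.
  by apply/existsP; exists v; apply/existsP; exists (f v); rewrite fe /=.
exact: rooted_tree_connected fT.
Qed.

(** If [f] and [g] differ at [v] but have the same edges, then the edge from [v] to
    [f v] is used by [g] in the opposite direction, [g (f v) = v], so that they
    differ at [f v] as well.  Iterating [f] brings this disagreement to the
    common root, where it is impossible. *)
Lemma parent_edges_inj e : {in [pred f | rooted_forest e [set j]%SET f] &, injective parent_edges}.
Proof.
move=> f g; rewrite !inE => fT gT fg.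
have [fj _ reach] := rooted_treeP fT; have [gj _ _] := rooted_treeP gT.
apply/ffunP => v; apply/eqP; apply/negPn/negP.
have /fconnect_iterP[k] := reach v; elim: k v => [v /= ->|k IH v].
  by rewrite fj gj eqxx.
rewrite iterSr => /IH {}IH fgv.
have vj : v != j by apply: contraNneq fgv => ->; rewrite fj gj.
have : [set v; f v]%SET \in parent_edges g by rewrite -fg; apply/parent_edgesP; left.
case/parent_edgesP => [[_ fgE]|[_ gfv]]; first by rewrite fgE eqxx in fgv.
apply: IH; rewrite -gfv; apply/eqP => ffv.
have vS : v \notin [set j]%SET by rewrite inE.
apply: (negP (rooted_forest_acyclic fT vS)).
by apply: fconnect_step; rewrite ffv connect0.
Qed.

(** The parent of a vertex is a neighbour that is closer to the root. *)
Lemma connected_rooted_tree r : connected_graph r ->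
  exists f, rooted_forest r [set j]%SET f.
Proof.
move=> conn.
have path_ex v : exists k, [exists p : k.-tuple V, path r v p && (last v p == j)].
  have /forallP/(_ v)/forallP/(_ j)/connectP[p rp ->] := conn.
  by exists (size p); apply/existsP; exists (in_tuple p); rewrite rp eqxx.
pose dist v := ex_minn (path_ex v).
have closer v : v != j -> exists w, r v w && (dist w < dist v)%N.
  move=> vj; rewrite {2}/dist; case: ex_minnP => k /existsP[[p pk]] /= /andP[rp pj] _.
  case: p rp pj pk => [|w p] /=; first by rewrite (negbTE vj).
  move=> /andP[vw rp] pj /eqP <-; exists w; rewrite vw /=.
  rewrite /dist; case: ex_minnP => l _; apply.
  by apply/existsP; exists (in_tuple p); rewrite rp.
pose f := [ffun v => if v == j then j else odflt v [pick w | r v w && (dist w < dist v)%N]].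
have fE v : v != j -> r v (f v) && (dist (f v) < dist v)%N.
  move=> vj; rewrite ffunE (negbTE vj); case: pickP => [w //|none].
  by have [w] := closer v vj; rewrite none.
exists f; apply/rooted_forestP; split=> v.
- by rewrite inE => /eqP ->; rewrite ffunE eqxx.
- by rewrite inE => /fE /andP[].
exists j; first by rewrite inE.
have [k] := ubnP (dist v); elim: k v => // k IH v; rewrite ltnS => vk.
have [->|vj] := eqVneq v j; first exact: connect0.
have /andP[_ fv] := fE v vj.
by apply: fconnect_step; apply: IH; apply: leq_trans fv vk.
Qed.

(** Any rooted tree [f] inside [F] uses all the edges of [F], because an unused
    edge would close a cycle with the path joining its ends in [f]. *)
Lemma spanning_tree_parent e F : irreflexive e -> symmetric e -> spanning_tree e F ->
  exists2 f, rooted_forest e [set j]%SET f & F = parent_edges f.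
Proof.
move=> e_irr e_sym /and3P[/fintype.subsetP Fe Fc /acyclic_graphP Fa].
have F_e v w : edge_rel F v w -> e v w.
  move=> /andP[vw /Fe]; rewrite inE => /existsP[x /existsP[y /andP[xy /eqP vwxy]]].
  have : v \in [set x; y]%SET by rewrite -vwxy set21.
  have : w \in [set x; y]%SET by rewrite -vwxy set22.
  rewrite !inE => /orP[]/eqP wE /orP[]/eqP vE; move: vw xy; rewrite wE vE ?eqxx //.
  by rewrite e_sym.
have [f fT] := connected_rooted_tree Fc; exists f.
  apply/rooted_forestP; case/rooted_forestP: fT => fj fe reach; split=> // v vj.
  exact: F_e (fe v vj).
have [_ fF _] := rooted_treeP fT.
have FfF : parent_edges f \subset F.
  apply/fintype.subsetP => A /imsetP[v]; rewrite !inE => vj ->.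
  by have /andP[] := fF v vj.
apply/eqP; rewrite finset.eqEsubset FfF andbT; apply/fintype.subsetP => A AF.
have := Fe A AF; rewrite inE => /existsP[a /existsP[b /andP[ab /eqP AE]]].
have a_b : a != b by apply: contraTneq ab => ->; rewrite e_irr.
rewrite {A}AE in AF *; apply/negPn/negP => abf.
have F_irr : irreflexive (edge_rel F) by move=> v; rewrite /edge_rel /= eqxx.
have /forallP/(_ a)/forallP/(_ b)/connectP[p0 rp0 bE] := rooted_tree_connected F_irr fT.
move: a_b ab AF abf; rewrite {b}bE; case/shortenP: rp0 => p rp up _ a_b ab AF abf.
apply: (negP (Fa (a :: p) _ _) up).
- case: p rp a_b abf {up ab AF} => [|b [|c p]] //=; first by rewrite eqxx.
  by rewrite andbT => /andP[_ abf] _; rewrite abf.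
- rewrite /= rcons_path edge_rel_sym /edge_rel /= a_b AF !andbT.
  apply: sub_path rp => v w /andP[vw /(fintype.subsetP FfF) vwF].
  by rewrite /edge_rel /= vw.
Qed.

Lemma num_rooted_treesE e : irreflexive e -> symmetric e ->
  num_rooted_trees e j = num_spanning_trees e.
Proof.
move=> e_irr e_sym; rewrite /num_rooted_trees /num_spanning_trees.
rewrite -(card_in_imset (f := parent_edges)); last first.
  by move=> f g; rewrite !inE => fT gT; apply: (@parent_edges_inj e).
apply: eq_card => F; apply/imsetP/idP => [[f]|].
  by rewrite !inE => fT ->; apply: rooted_tree_spanning.
by rewrite inE => /(spanning_tree_parent e_irr e_sym)[f fT ->]; exists f; rewrite ?inE.
Qed.

Lemma num_spanning_trees_gt0 e : irreflexive e -> symmetric e -> connected_graph e ->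
  (0 < num_spanning_trees e)%N.
Proof.
move=> e_irr e_sym /connected_rooted_tree[f fT]; rewrite -num_rooted_treesE //.
by apply/card_gt0P; exists f; rewrite inE.
Qed.

End SpanningTrees.

(** * Firing moves and the Laplacian *)

Lemma Posz_sum (I : Type) (s : seq I) (P : pred I) (F : I -> nat) :
  (\sum_(k <- s | P k) F k)%N%:Z = \sum_(k <- s | P k) (F k)%:Z.
Proof. exact: (big_morph Posz PoszD erefl). Qed.

Section Firing.

Variables (V : finType) (e : rel V).
Hypotheses (e_sym : symmetric e) (e_irr : irreflexive e).
Implicit Types (x y u : V -> int) (v w i j : V).

Definition laplacian x w : int := \sum_(v | e w v) (x w - x v).

(** These are the principal divisors in the terminology of divisor theory on
    graphs. *)
Definition principal u : Prop := exists x, forall w, u w = laplacian x w.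

Lemma laplacianD x y w :
  laplacian (fun v => x v + y v) w = laplacian x w + laplacian y w.
Proof. by rewrite /laplacian -big_split /=; apply: eq_bigr => v _; ring. Qed.

Lemma laplacianZ (a : int) x w :
  laplacian (fun v => a * x v) w = a * laplacian x w.
Proof. by rewrite /laplacian mulr_sumr; apply: eq_bigr => v _; ring. Qed.

Lemma laplacian_const (a : int) w : laplacian (fun=> a) w = 0.
Proof. by rewrite /laplacian big1 // => v _; rewrite subrr. Qed.

Lemma eq_laplacian x y w : x =1 y -> laplacian x w = laplacian y w.
Proof. by move=> xy; apply: eq_bigr => v _; rewrite !xy. Qed.

Lemma laplacian_indicator i w :
  laplacian (fun v => (i == v)%:Z) w =
  (if w == i then (degree e i)%:Z else 0) - (if e i w then 1 else 0).
Proof.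
rewrite /laplacian sumrB; congr (_ - _).
  rewrite eq_sym; case: eqP => [->|_]; last by rewrite big1.
  rewrite sumr_const /degree -[RHS]natz; congr (_ *+ _).
  by apply: eq_card => v; rewrite !inE.
rewrite big_mkcond /= (bigD1 i) //= eqxx big1 ?addr0; first by rewrite e_sym.
by move=> v vi; rewrite eq_sym (negbTE vi); case: ifP.
Qed.

Lemma sum_laplacian x : \sum_w laplacian x w = 0.
Proof.
under eq_bigr do rewrite /laplacian sumrB; rewrite sumrB /=.
apply/eqP; rewrite subr_eq0; apply/eqP.
rewrite [RHS](exchange_big_dep predT) //=.
by apply: eq_bigr => v _; apply: eq_bigl => w; rewrite e_sym.
Qed.

Lemma foldl_fireE (C : {ffun V -> int}) (s : seq V) w :
  foldl (fire e) C s w = C w - laplacian (fun v => (count_mem v s)%:Z) w.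
Proof.
elim: s C => [|i s IH] C /=.
  by rewrite (laplacian_const 0) subr0.
rewrite IH ffunE.
rewrite [in RHS](@eq_laplacian _ (fun v => (i == v)%:Z + (count_mem v s)%:Z)) //.
by rewrite laplacianD laplacian_indicator; ring.
Qed.

(** The number of times each vertex is fired is a potential for the change.
    Conversely, firing every vertex once is neutral, so a potential can be
    shifted to nonnegative values and read as numbers of firings. *)
Lemma debt_reachableP (C C' : configuration V) :
  debt_reachable e C C' <-> principal (fun w => (C w)%:Z - (C' w)%:Z).
Proof.
split=> [[s /ffunP sC]|[x xC]].
  exists (fun v => (count_mem v s)%:Z) => w.
  by have := sC w; rewrite foldl_fireE !ffunE => <-; ring.
pose M := (\sum_v absz (x v))%N.
pose y v := absz (x v + M%:Z).
have yE v : (y v)%:Z = x v + M%:Z.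
  have : (absz (x v) <= M)%N by rewrite /M (bigD1 v) //= leq_addr.
  by rewrite /y; lia.
exists (flatten [seq nseq (y v) v | v <- enum V]).
apply/ffunP => w; rewrite foldl_fireE !ffunE.
have countE v : count_mem v (flatten [seq nseq (y v) v | v <- enum V]) = y v.
  rewrite count_flatten -map_comp sumnE big_map big_enum /=.
  rewrite (bigD1 v) //= count_nseq /= eqxx mul1n big1 ?addn0 // => i iv.
  by rewrite count_nseq /= (negbTE iv).
rewrite (@eq_laplacian _ (fun v => x v + M%:Z)); last by move=> v; rewrite countE yE.
by rewrite laplacianD laplacian_const addr0 -xC; ring.
Qed.

Lemma eq_principal u u' : u =1 u' -> principal u -> principal u'.
Proof. by move=> uu' [x ux]; exists x => w; rewrite -uu'. Qed.

Lemma principal0 : principal (fun=> 0).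
Proof. by exists (fun=> 0) => w; rewrite laplacian_const. Qed.

Lemma principalD u u' : principal u -> principal u' -> principal (fun w => u w + u' w).
Proof.
by move=> [x ux] [y uy]; exists (fun v => x v + y v) => w; rewrite laplacianD ux uy.
Qed.

Lemma principalZ (a : int) u : principal u -> principal (fun w => a * u w).
Proof. by move=> [x ux]; exists (fun v => a * x v) => w; rewrite laplacianZ ux. Qed.

Lemma principal_sum (I : Type) (s : seq I) (F : I -> V -> int) :
  (forall k, principal (F k)) -> principal (fun w => \sum_(k <- s) F k w).
Proof.
move=> FP; elim: s => [|k s IH].
  by apply: eq_principal principal0 => w; rewrite big_nil.
by apply: eq_principal (principalD (FP k) IH) => w; rewrite big_cons.
Qed.

Lemma sum_principal u : principal u -> \sum_w u w = 0.
Proof. by move=> [x ux]; rewrite (eq_bigr _ (fun w _ => ux w)) sum_laplacian. Qed.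

Lemma laplacian_potential i j w : w != j ->
  i != j -> laplacian (fun v => (potential e i j v)%:Z) w =
            (w == i)%:Z * (num_spanning_trees e)%:Z.
Proof.
move=> wj ij; rewrite /laplacian sumrB -(num_rooted_treesE j) //.
have [->|wi] := eqVneq w i.
  by rewrite -!Posz_sum potential_source // PoszD addrAC subrr add0r mul1r.
by rewrite -!Posz_sum potential_harmonic // subrr mul0r.
Qed.

(** The potential counting forests has the right Laplacian away from [j]; its
    value at [j] is forced because a Laplacian sums to zero. *)
Lemma principal_num_spanning_trees i j :
  principal (fun w => (num_spanning_trees e)%:Z * ((w == i)%:Z - (w == j)%:Z)).
Proof.
have [->|ij] := eqVneq i j.
  by apply: eq_principal principal0 => w; rewrite subrr mulr0.
exists (fun v => (potential e i j v)%:Z) => w.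
have [->|wj] := eqVneq w j; last by rewrite laplacian_potential // subr0 mulrC.
have := sum_laplacian (fun v => (potential e i j v)%:Z).
rewrite (bigD1 j) //= (bigD1 i) //= big1 => [|v /andP[vj vi]]; last first.
  by rewrite laplacian_potential // (negbTE vi) mul0r.
rewrite (laplacian_potential ij ij) eqxx eq_sym (negbTE ij) => h.
by move/eqP: h; rewrite addr0 mul1r addr_eq0 => /eqP ->; rewrite sub0r mulrN1.
Qed.

End Firing.

(** * Counting vectors satisfying a periodic condition *)

Section PeriodicCount.

Variables (m k : nat) (k_gt0 : (0 < k)%N).
Implicit Types (c : nat) (r : {ffun 'I_m -> 'I_k}).

Definition weight r : nat := (\sum_i r i)%N.

Lemma weight_le r : (weight r <= m * k)%N.
Proof.
rewrite /weight -[m in (m * k)%N]card_ord -sum_nat_const.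
by apply: leq_sum => i _; apply: ltnW.
Qed.

Definition residues c (g : {ffun 'I_m -> 'I_c.+1}) : {ffun 'I_m -> 'I_k} :=
  [ffun i => Ordinal (ltn_pmod (g i) k_gt0)].

(** Vectors [g] with residues [r] are the [k * z + r], and the bound on the sum of
    [g] becomes a bound on the sum of [z]. *)
Lemma card_residue_class_small c r : (weight r <= c)%N ->
  #|[set g : {ffun 'I_m -> 'I_c.+1} |
      (\sum_i g i <= c)%N && (residues g == r)]%SET| =
  'C(m + (c - weight r) %/ k, m).
Proof.
move=> rc; set t := ((c - weight r) %/ k)%N.
have tc : (k * t + weight r <= c)%N.
  by rewrite mulnC; have := leq_trunc_div (c - weight r) k; rewrite -/t; lia.
rewrite -card_partial_ord_partitions.
pose digits (z : m.-tuple 'I_t.+1) : {ffun 'I_m -> 'I_c.+1} :=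
  [ffun i => inord (k * tnth z i + r i)].
have digitsE z i : nat_of_ord (digits z i) = (k * tnth z i + r i)%N.
  rewrite ffunE inordK // ltnS; apply: leq_trans tc; apply: leq_add.
    by rewrite leq_mul2l -ltnS ltn_ord orbT.
  by rewrite /weight (bigD1 i) //= leq_addr.
rewrite -(card_imset (f := digits)) => [|z z' zz']; last first.
  apply: eq_from_tnth => i; apply: val_inj.
  have /(congr1 (@nat_of_ord _)) := congr1 (fun g : {ffun _ -> _} => g i) zz'.
  by rewrite !digitsE => /addIn/eqP; rewrite eqn_pmul2l // => /eqP.
have sumE (y : 'I_m -> nat) :
    (\sum_i (k * y i + r i) <= c)%N = (\sum_i y i <= t)%N.
  rewrite big_split /= -big_distrr /= -/(weight r) /t leq_divRL //.
  by rewrite mulnC leq_subRL // addnC.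
apply: eq_card => g; rewrite inE; apply/andP/imsetP => [[gc /eqP gr]|[z]].
  have gE i : nat_of_ord (g i) = (k * (g i %/ k) + r i)%N.
    by rewrite -gr ffunE /= mulnC -divn_eq.
  have gt : (\sum_i (g i %/ k) <= t)%N by rewrite -sumE -(eq_bigr _ (fun i _ => gE i)).
  have git i : (g i %/ k < t.+1)%N.
    by rewrite ltnS; apply: leq_trans gt; rewrite (bigD1 i) //= leq_addr.
  exists [tuple Ordinal (git i) | i < m].
    by rewrite inE big_tuple; under eq_bigr do rewrite tnth_mktuple.
  by apply/ffunP => i; apply: val_inj; rewrite /= digitsE tnth_mktuple /= -gE.
rewrite inE big_tuple => zt ->; split.
  by under eq_bigr do rewrite digitsE; rewrite sumE.
apply/eqP/ffunP => i; apply: val_inj; rewrite ffunE /= digitsE.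
by rewrite mulnC modnMDl modn_small.
Qed.

(** The shift by [m * k] lets a single binomial cover the empty classes too:
    when [c < weight r] its upper index is less than [m]. *)
Lemma card_residue_class c r :
  #|[set g : {ffun 'I_m -> 'I_c.+1} |
      (\sum_i g i <= c)%N && (residues g == r)]%SET| =
  'C((c + m * k - weight r) %/ k, m).
Proof.
have rmk := weight_le r.
have [rc|cr] := leqP (weight r) c.
  rewrite card_residue_class_small //; congr 'C(_, m).
  by rewrite [(c + _)%N]addnC -addnBA // divnMDl.
rewrite bin_small; last by rewrite ltn_divLR //; lia.
apply/eqP; rewrite cards_eq0; apply/eqP/setP => g; rewrite !inE.
apply/negP => /andP[gc /eqP gr].
have : (weight r <= \sum_i g i)%N.
  by apply: leq_sum => i _; rewrite -gr ffunE /= leq_mod.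
by move/leq_trans/(_ gc); rewrite leqNgt cr.
Qed.

(** Each residue vector either satisfies [P] or not, and with it all the vectors
    of its class. *)
Lemma card_periodic (P : pred {ffun 'I_m -> nat}) c :
  (forall y y' : {ffun 'I_m -> nat}, (forall i, y i = y' i %[mod k]) -> P y = P y') ->
  #|[set g : {ffun 'I_m -> 'I_c.+1} |
      (\sum_i g i <= c)%N && P [ffun i => nat_of_ord (g i)]]%SET| =
  (\sum_(r : {ffun 'I_m -> 'I_k} | P [ffun i => nat_of_ord (r i)])
     'C((c + m * k - weight r) %/ k, m))%N.
Proof.
move=> Pper; rewrite -sum1_card.
rewrite (partition_big (@residues c) (fun r => P [ffun i => nat_of_ord (r i)])) /=.
  apply: eq_bigr => r Pr; rewrite -card_residue_class sum1_card; apply: eq_card => g.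
  rewrite !inE unfold_in /= inE; case: eqP => [gr|]; rewrite ?andbF ?andbT //.
  suff -> : P [ffun i => nat_of_ord (g i)] by rewrite andbT.
  by rewrite (Pper _ [ffun i => nat_of_ord (r i)]) // => i; rewrite !ffunE -gr ffunE /= modn_mod.
move=> g; rewrite inE => /andP[_ Pg].
by rewrite (Pper _ [ffun i => nat_of_ord (g i)]) // => i; rewrite !ffunE /= modn_mod.
Qed.

End PeriodicCount.

(** * Quasipolynomials *)

Section IntegerBinomial.

(** The binomial coefficient with an integer upper index; at [Negz a], which is
    [- (a + 1)], this is the reflection formula. *)
Definition binz (t : int) (m : nat) : int :=
  match t with
  | Posz a => 'C(a, m)%:Z
  | Negz a => (-1) ^+ m * 'C(a + m, m)%:Z
  end.

Definition binpoly (m : nat) : {poly rat} :=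
  (m`!%:R)^-1 *: \prod_(j < m) ('X - (j%:R)%:P).

Lemma size_binpoly m : size (binpoly m) = m.+1.
Proof.
rewrite size_scale ?invr_eq0 ?pnatr_eq0 -?lt0n ?fact_gt0 //.
by rewrite size_prod_XsubC /index_enum -enumT size_enum_ord.
Qed.

Lemma lead_coef_binpoly m : lead_coef (binpoly m) = (m`!%:R)^-1.
Proof. by rewrite lead_coefZ (monicP (monic_prod_XsubC _ _ _)) mulr1. Qed.

Lemma binpolyE m (t : int) : (binpoly m).[t%:~R] = (binz t m)%:~R.
Proof.
rewrite /binpoly hornerZ horner_prod.
under eq_bigr do rewrite hornerXsubC.
have mf : m`!%:R != 0 :> rat by rewrite pnatr_eq0 -lt0n fact_gt0.
apply: (mulfI mf); rewrite mulrA divff // mul1r.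
case: t => a /=.
  rewrite -[_%:~R in RHS]/('C(a, m)%:R) -natrM mulnC bin_ffact.
  elim: m {mf} => [|m IH]; first by rewrite big_ord0.
  rewrite big_ord_recr /= IH ffactnSr natrM.
  have [ma|am] := leqP m a; first by rewrite natrB.
  by rewrite ffact_small // !mul0r.
rewrite rmorphM rmorphXn /= rmorphN1 mulrCA.
rewrite -[_%:~R in RHS]/('C(a + m, m)%:R) -natrM mulnC bin_ffact.
rewrite NegzE rmorphN /=.
elim: m {mf} => [|m IH]; first by rewrite big_ord0 expr0 mul1r.
rewrite big_ord_recr /= IH addnS ffactSS natrM exprS.
rewrite -[intmul 1 (Posz a.+1)]/(a.+1%:R) -!natr1 natrD; ring.
Qed.

End IntegerBinomial.

Section Quasipolynomials.

Lemma has_period_mul (T : Type) (a : int -> T) p l :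
  has_period a p -> forall k, a (k + (l * p)%N%:Z) = a k.
Proof.
move=> [_ ap]; elim: l => [|l IH] k; first by rewrite addr0.
by rewrite mulSn PoszD addrA IH ap.
Qed.

(** The remainder of [k] modulo the least period [p] is again a shift that fixes
    [a], so by minimality it vanishes. *)
Lemma minimal_period (T : Type) (a : int -> T) k :
  has_period a k -> exists2 p, is_period a p & (p %| k)%N.
Proof.
move=> ak.
have ex : exists p, `[< has_period a p >] by exists k; apply/asboolP.
case: (ex_minnP ex) => p /asboolP ap pmin.
have pmin' p' : has_period a p' -> (p <= p')%N by move=> ?; apply/pmin/asboolP.
exists p => //; rewrite /dvdn -leqn0 leqNgt; apply/negP => kp_gt0.
have : has_period a (k %% p)%N.
  split=> // l; rewrite -(has_period_mul (k %/ p) ap) -addrA -PoszD addnC -divn_eq.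
  by have [_ ->] := ak.
by move/pmin'; rewrite leqNgt ltn_pmod //; case: ap.
Qed.

(** A periodic family of polynomials of bounded degree packages all the
    coefficients of a quasipolynomial at once. *)
Lemma quasipolynomial_of_poly (q : int -> int) (A : int -> {poly rat}) (d k : nat) :
  (0 < k)%N -> (forall l, A (l + k%:Z) = A l) -> (forall l, (size (A l) <= d.+1)%N) ->
  (exists l, (A l)`_d != 0) -> (forall l, (q l)%:~R = (A l).[l%:~R]) ->
  exists2 p, is_quasipolynomial q d p & (p %| k)%N.
Proof.
move=> k_gt0 Aper Asize [l0 Al0] qA.
have per i : exists p, is_period (fun l => (A l)`_i) p /\ (p %| k)%N.
  have [|p] := @minimal_period _ (fun l => (A l)`_i) k; last by exists p.
  by split=> // l; rewrite Aper.
pose pr (i : 'I_d.+1) := sval (cid (per i)).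
have prP (i : 'I_d.+1) : is_period (fun l => (A l)`_i) (pr i) /\ (pr i %| k)%N := svalP (cid (per i)).
exists (\big[lcmn/1%N]_(i < d.+1) pr i).
  exists (fun (i : 'I_d.+1) l => (A l)`_i), pr; split=> //.
  - by move=> i; case: (prP i).
  - by exists l0; apply/eqP.
  - by move=> l; rewrite qA (horner_coef_wide _ (Asize l)).
apply: (big_ind (fun x => (x %| k)%N)) => [|x y xk yk|i _]; first exact: dvd1n.
  by rewrite dvdn_lcm xk.
by case: (prP i).
Qed.

End Quasipolynomials.

Section CountQuasipolynomial.

Variables (m k : nat) (k_gt0 : (0 < k)%N).
Variable R : pred {ffun 'I_m -> 'I_k}.

(** The sum of [card_periodic], extended to integers: the numerator of the quotient
    is [l + m * k - weight r]. *)
Definition periodic_count (l : int) : int :=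
  \sum_(r | R r) binz ((l + ((m * k)%N%:Z - (weight r)%:Z)) %/ k%:Z)%Z m.

Lemma periodic_count_nat (c : nat) :
  periodic_count c%:Z = (\sum_(r | R r) 'C((c + m * k - weight r) %/ k, m))%N%:Z.
Proof.
rewrite Posz_sum; apply: eq_bigr => r _.
have rmk := weight_le r.
by rewrite subzn // -PoszD addnBA // divz_nat.
Qed.

(** The floor of [(l + s) / k] is [(x + s - (l + s) mod k) / k] at [x = l], where the
    remainder depends only on [l] modulo [k]. *)
Definition residue_poly (l : int) (r : {ffun 'I_m -> 'I_k}) : {poly rat} :=
  let s := (m * k)%N%:Z - (weight r)%:Z in
  binpoly m \Po
    ((k%:R)^-1 *: 'X + (k%:R^-1 * (s - ((l + s) %% k%:Z)%Z)%:~R)%:P).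

Lemma periodic_count_quasipolynomial :
  (exists r, R r) ->
  exists2 p, is_quasipolynomial periodic_count m p & (p %| k)%N.
Proof.
move=> [r0 Rr0].
have kn0 : k%:R^-1 != 0 :> rat by rewrite invr_eq0 pnatr_eq0 -lt0n.
have size_in (b : rat) : size ((k%:R)^-1 *: 'X + b%:P) = 2%N.
  by rewrite size_polyDl size_scale ?size_polyX // ltnS size_polyC leq_b1.
have lead_in (b : rat) : lead_coef ((k%:R)^-1 *: 'X + b%:P) = k%:R^-1.
  by rewrite lead_coefDl ?lead_coefZ ?lead_coefX ?mulr1 // size_scale ?size_polyX // ltnS size_polyC leq_b1.
have size_rp l r : size (residue_poly l r) = m.+1.
  by rewrite /residue_poly size_comp_poly2 ?size_binpoly.
have lead_rp l r : (residue_poly l r)`_m = (m`!%:R)^-1 * k%:R^-1 ^+ m.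
  have -> : (residue_poly l r)`_m = lead_coef (residue_poly l r).
    by rewrite lead_coefE size_rp.
  by rewrite lead_coef_comp ?size_in // lead_coef_binpoly lead_in size_binpoly.
apply: (@quasipolynomial_of_poly _ (fun l => \sum_(r | R r) residue_poly l r)) => //.
- move=> l; apply: eq_bigr => r _; rewrite /residue_poly.
  set s := (m * k)%N%:Z - (weight r)%:Z.
  by rewrite (_ : l + k%:Z + s = l + s + k%:Z) ?modzDr //; ring.
- move=> l; apply: leq_trans (size_sum _ _ _) _.
  by apply/bigmax_leqP => r _; rewrite size_rp.
- exists 0; rewrite coef_sum (eq_bigr _ (fun r _ => lead_rp 0 r)) sumr_const.
  rewrite mulrn_eq0 negb_or mulf_neq0 ?expf_neq0 ?invr_eq0 ?pnatr_eq0 -?lt0n ?fact_gt0 //.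
  by rewrite andbT; apply/card_gt0P; exists r0.
- move=> l; rewrite horner_sum rmorph_sum /=; apply: eq_bigr => r _.
  rewrite /residue_poly horner_comp -binpolyE; congr (_.[_]).
  set s := (m * k)%N%:Z - (weight r)%:Z.
  rewrite hornerD hornerZ hornerX hornerC -mulrDr -rmorphD /=.
  have -> : l + (s - ((l + s) %% k%:Z)%Z) = ((l + s) %/ k%:Z)%Z * k%:Z.
    by apply/eqP; rewrite addrA subr_eq; apply/eqP/divz_eq.
  rewrite rmorphM /= mulrC mulfK //.
  by rewrite pnatr_eq0 -lt0n.
Qed.

End CountQuasipolynomial.

(** * Reachable configurations from a single pile *)

Section Reachable.

Variables (m : nat) (e : rel 'I_m.+1).
Hypotheses (e_sym : symmetric e) (e_irr : irreflexive e).

(** The difference between all chips on [ord0] and the configuration with [y i] chips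
    on [lift ord0 i] does not depend on the total number of chips. *)
Definition chips_moved (y : {ffun 'I_m -> nat}) (w : 'I_m.+1) : int :=
  if unlift ord0 w is Some i then - (y i)%:Z else (\sum_i y i)%N%:Z.

Definition complete_configuration (c : nat) (y : {ffun 'I_m -> nat}) :
    configuration 'I_m.+1 :=
  [ffun w => if unlift ord0 w is Some i then y i else (c - \sum_i y i)%N].

Lemma chips_movedE c (y : {ffun 'I_m -> nat}) w : (\sum_i y i <= c)%N ->
  (all_chips_at ord0 c w)%:Z - (complete_configuration c y w)%:Z = chips_moved y w.
Proof.
move=> yc; rewrite /chips_moved !ffunE; case: unliftP => [i|] ->.
  by rewrite eq_sym (negbTE (neq_lift _ _)) sub0r.
by rewrite eqxx subzn ?leq_subr // subKn.
Qed.

(** Congruent vectors differ by an integer combination of the vectors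
    [k * (e_i - e_0)], all of which are principal. *)
Lemma chips_moved_periodic (y y' : {ffun 'I_m -> nat}) :
  (forall i, y i = y' i %[mod num_spanning_trees e]) ->
  principal e (chips_moved y) -> principal e (chips_moved y').
Proof.
move=> yy' yP; set k := num_spanning_trees e in yy'.
have diff i : {d : int | (y i)%:Z - (y' i)%:Z = k%:Z * d}.
  exists ((y i %/ k)%N%:Z - (y' i %/ k)%N%:Z).
  rewrite {1}(divn_eq (y i) k) {1}(divn_eq (y' i) k) yy' !PoszD !PoszM; ring.
pose d i := sval (diff i).
pose F (i : 'I_m) (w : 'I_m.+1) : int :=
  d i * (k%:Z * ((w == lift ord0 i)%:Z - (w == ord0)%:Z)).
have FP i : principal e (F i) by apply/principalZ/principal_num_spanning_trees.
have FE i w : F i w = ((y i)%:Z - (y' i)%:Z) * ((w == lift ord0 i)%:Z - (w == ord0)%:Z).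
  by rewrite (svalP (diff i)) /F -/(d i); ring.
apply: eq_principal (principalD yP (principal_sum (index_enum _) FP)) => w.
under eq_bigr do rewrite FE.
rewrite /chips_moved; case: unliftP => [i|] ->.
  rewrite (bigD1 i) //= eqxx big1 => [|i' i'i].
    by rewrite subr0 mulr1; lia.
  have /negbTE -> : lift ord0 i != lift ord0 i'.
    by apply: contra_neq i'i => /lift_inj ->.
  by rewrite subrr mulr0.
rewrite !Posz_sum -big_split /=; apply: eq_bigr => i _.
by rewrite sub0r; lia.
Qed.

Definition completion (c : nat) (g : {ffun 'I_m -> 'I_c.+1}) : configuration 'I_m.+1 :=
  complete_configuration c [ffun i => nat_of_ord (g i)].

Lemma completion_inj c : injective (@completion c).
Proof.
move=> g h gh; apply/ffunP => i; apply: val_inj.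
by have := congr1 (fun C : configuration _ => C (lift ord0 i)) gh; rewrite !ffunE liftK !ffunE.
Qed.

(** Firing conserves the number of chips, so the base vertex holds the chips that
    the other vertices leave over, and no entry exceeds [c]. *)
Lemma reachable_setE c :
  reachable_set e (all_chips_at ord0 c) =
  [set` [fset completion g | g in [set g : {ffun 'I_m -> 'I_c.+1} |
     (\sum_i g i <= c)%N &&
     `[< principal e (chips_moved [ffun i => nat_of_ord (g i)]) >]]%SET]%fset]%classic.
Proof.
have sumE (g : {ffun 'I_m -> 'I_c.+1}) :
    (\sum_i [ffun i => nat_of_ord (g i)] i = \sum_i g i)%N.
  by apply: eq_bigr => i _; rewrite ffunE.
apply/seteqP; split=> C /=.
  move=> /(debt_reachableP e_sym) CP.
  have sumC : (\sum_w C w = c)%N.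
    have := sum_principal e_sym CP; rewrite sumrB -!Posz_sum => /eqP.
    rewrite subr_eq0 => /eqP[<-]; rewrite (bigD1 ord0) //= ffunE eqxx big1 ?addn0 //.
    by move=> w w0; rewrite ffunE (negbTE w0).
  rewrite big_ord_recl in sumC.
  have Cc i : (C (lift ord0 i) < c.+1)%N.
    by rewrite ltnS -sumC (bigD1 i) //= addnCA leq_addr.
  pose g : {ffun 'I_m -> 'I_c.+1} := [ffun i => Ordinal (Cc i)].
  have sumg : (\sum_i g i = \sum_i C (lift ord0 i))%N.
    by apply: eq_bigr => i _; rewrite ffunE.
  have gc : (\sum_i g i <= c)%N by rewrite sumg -sumC leq_addl.
  have CE : C = completion g.
    apply/ffunP => w; rewrite ffunE sumE; case: unliftP => [i|] ->.
      by rewrite !ffunE.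
    by rewrite sumg -sumC addnK.
  apply/imfsetP; exists g => //=; rewrite inE gc /=; apply/asboolP.
  apply: eq_principal CP => w; rewrite CE; apply: chips_movedE.
  by rewrite sumE.
move=> /imfsetP[g /=]; rewrite inE => /andP[gc /asboolP gP] ->.
apply/(debt_reachableP e_sym); apply: eq_principal gP => w.
by rewrite chips_movedE // sumE.
Qed.

End Reachable.

Theorem theorem4p1 (n : nat) (n_gt0 : (0 < n)%N) (e : rel 'I_n)
    (e_sym : symmetric e) (e_irr : irreflexive e)
    (e_conn : connected_graph e) :
  exists (q : int -> int) (p : nat),
    [/\ is_quasipolynomial q n.-1 p,
        (p %| num_spanning_trees e)%N
      & forall c : nat,
          let A := reachable_set e (all_chips_at (Ordinal n_gt0) c) in
          finite_set A /\ (#|` fset_set A|)%:Z = q c%:Z].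
Proof.
case: n n_gt0 e e_sym e_irr e_conn => // m n_gt0 e e_sym e_irr e_conn.
have -> : Ordinal n_gt0 = ord0 by exact: val_inj.
have k_gt0 := num_spanning_trees_gt0 ord0 e_irr e_sym e_conn.
pose P (y : {ffun 'I_m -> nat}) := `[< principal e (chips_moved y) >].
have Pper (y y' : {ffun 'I_m -> nat}) :
    (forall i, y i = y' i %[mod num_spanning_trees e]) -> P y = P y'.
  move=> yy'; apply: asbool_equiv_eq; split; apply: chips_moved_periodic => //.
pose R (r : {ffun 'I_m -> 'I_(num_spanning_trees e)}) := P [ffun i => nat_of_ord (r i)].
(* The starting configuration itself lies in the class of the zero residues. *)
have R0 : exists r, R r.
  exists [ffun=> Ordinal k_gt0]; apply/asboolP; apply: eq_principal (principal0 e) => w.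
  rewrite /chips_moved; case: unlift => [i|]; first by rewrite !ffunE.
  by rewrite big1 // => i _; rewrite !ffunE.
have [p qP pk] := periodic_count_quasipolynomial k_gt0 R0.
exists (periodic_count R), p; split=> // c /=.
rewrite reachable_setE //; split; first exact: finite_fset.
rewrite set_fsetK periodic_count_nat //; congr Posz.
rewrite -(card_periodic k_gt0 c Pper) card_imfset /=; last exact: completion_inj.
by rewrite cardE.
Qed.
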